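(* For two graphs $F$ and $G$, $t(F,G)=1$ if and only if $F=(K_n)^c$ for some natural number $n$ (that is, $F$ is, up to isomorphism, the complement of a complete graph, i.e. $F$ has no edges).
   Context: All graphs are simple and undirected (no loops, at most one edge between each pair of vertices), finite, and have at least one vertex; natural numbers are positive here. $V(G)$ and $E(G)$ denote the vertex and edge sets of $G$; $K_n$ is the complete graph on $n$ vertices and $(\cdot)^c$ denotes graph complement. A mapping $\varphi:F\to G$ between graphs means an arbitrary function $V(F)\to V(G)$. It is a graph homomorphism if $v_1v_2\in E(F)$ implies $\varphi(v_1)\varphi(v_2)\in E(G)$. The homomorphism density is $t(F,G)=\frac{|H|}{|M|}$, where $M$ is the set of all mappings from $F$ to $G$ and $H\subseteq M$ is the set of those that are graph homomorphisms. *)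

(* Defs.v *)
From mathcomp Require Import all_boot all_order all_algebra.

Set Implicit Arguments.
Unset Strict Implicit.
Unset Printing Implicit Defensive.

Import GRing.Theory.

Record sgraph := SGraph {
  vertex :> finType;
  edge : rel vertex;
  edge_sym : symmetric edge;
  edge_irrefl : irreflexive edge;
  vertex_gt0 : 0 < #|vertex|
}.

Definition complete_rel (T : finType) : rel T := fun x y => x != y.

Lemma complete_sym (T : finType) : symmetric (@complete_rel T).
Proof. by move=> x y; rewrite /complete_rel eq_sym. Qed.

Lemma complete_irrefl (T : finType) : irreflexive (@complete_rel T).
Proof. by move=> x; rewrite /complete_rel eqxx. Qed.

Lemma ord_gt0 (n : nat) : 0 < n -> 0 < #|'I_n|.
Proof. by rewrite card_ord. Qed.

(* K_n; positivity of n is required because an sgraph has a vertex. *)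
Definition complete (n : nat) (n_gt0 : 0 < n) : sgraph :=
  SGraph (@complete_sym 'I_n) (@complete_irrefl 'I_n) (ord_gt0 n_gt0).

Definition compl_rel (G : sgraph) : rel G :=
  fun x y => (x != y) && ~~ edge x y.

Lemma compl_sym (G : sgraph) : symmetric (@compl_rel G).
Proof. by move=> x y; rewrite /compl_rel eq_sym edge_sym. Qed.

Lemma compl_irrefl (G : sgraph) : irreflexive (@compl_rel G).
Proof. by move=> x; rewrite /compl_rel eqxx. Qed.

Definition compl (G : sgraph) : sgraph :=
  SGraph (@compl_sym G) (@compl_irrefl G) (vertex_gt0 G).

Definition isomorphic (F G : sgraph) : Prop :=
  exists f : F -> G, bijective f /\ {mono f : x y / edge x y}.

Definition is_hom (F G : sgraph) (f : F -> G) : bool :=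
  [forall x, forall y, edge x y ==> edge (f x) (f y)].

Definition hom_density (F G : sgraph) : rat :=
  (#|[set f : {ffun F -> G} | is_hom f]|%:R / #|{ffun F -> G}|%:R)%R.

(* Main.v *)
Require Import Defs.
From mathcomp Require Import all_boot all_order all_algebra.

(** The density is 1 exactly when every map from F to G is a homomorphism, since
    both cardinals are finite and the denominator is nonzero. A constant map,
    which exists because G has a vertex, sends any edge of F to a loop; G has
    none, so F must be edgeless if all maps are homomorphisms, and the converse
    is vacuous. Finally, an edgeless graph is determined up to isomorphism by
    its number of vertices, and the complement of K_n is edgeless. *)

(** A subset of a finite type with full cardinality is the whole type. Some map
    F -> G exists because G has a vertex; without one the quotient would be
    0 / 0, which is 0, although every map would vacuously be a homomorphism. *)
Lemma hom_density_eq1 (F G : sgraph) :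
  hom_density F G = 1%R <-> forall f : {ffun F -> G}, is_hom f.
Proof.
have maps_gt0 : 0 < #|{ffun F -> G}| by rewrite card_ffun expn_gt0 vertex_gt0.
have maps_neq0 : (#|{ffun F -> G}|%:R != 0 :> rat)%R.
  by rewrite Num.Theory.pnatr_eq0 -lt0n.
rewrite /hom_density; split=> [density1 f | all_hom].
- have homsT : [set h : {ffun F -> G} | is_hom h] = [set: {ffun F -> G}].
    apply/eqP; rewrite eqEcard subsetT cardsT /= -(Num.Theory.ler_nat rat).
    by rewrite -[X in (_ <= X)%R](GRing.divfK maps_neq0) density1 GRing.mul1r.
  by have := in_setT f; rewrite -homsT inE.
- have -> : [set h : {ffun F -> G} | is_hom h] = [set: {ffun F -> G}].
    by apply/setP=> f; rewrite !inE all_hom.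
  by rewrite cardsT GRing.divff.
Qed.

(** A constant map turns an edge of F into a loop of G, which is excluded. *)
Lemma all_hom_edgeless (F G : sgraph) :
  (forall f : {ffun F -> G}, is_hom f) <->
  (forall x y : F, edge x y = false).
Proof.
split=> [all_hom x y | edgeless f]; last first.
  by apply/forallP=> x; apply/forallP=> y; rewrite edgeless.
have /card_gt0P [g _] := vertex_gt0 G.
have /forallP /(_ x) /forallP /(_ y) := all_hom [ffun=> g].
by rewrite !ffunE edge_irrefl implybF => /negbTE.
Qed.

Lemma edge_compl_complete (n : nat) (n_gt0 : 0 < n)
    (i j : compl (complete n_gt0)) :
  edge i j = false.
Proof. by rewrite /= /compl_rel /= /complete_rel andbN. Qed.

(** Any bijection between edgeless graphs is an isomorphism, so the enumeration
    of the vertices of F will do. *)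
Lemma edgeless_isomorphic (F : sgraph) :
  (forall x y : F, edge x y = false) <->
  exists (n : nat) (n_gt0 : 0 < n), isomorphic F (compl (complete n_gt0)).
Proof.
split=> [edgeless | [n [n_gt0 [f [_ f_mono]]]] x y]; last first.
  by rewrite -f_mono edge_compl_complete.
exists #|F|, (vertex_gt0 F), (@enum_rank F); split.
  exact: enum_rank_bij.
by move=> x y; rewrite edge_compl_complete edgeless.
Qed.

Theorem theorem2p1 (F G : sgraph) :
  hom_density F G = 1%R <->
  exists (n : nat) (n_gt0 : 0 < n), isomorphic F (compl (complete n_gt0)).
Proof.
exact: iff_trans (hom_density_eq1 F G)
         (iff_trans (all_hom_edgeless F G) (edgeless_isomorphic F)).
Qed.
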